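(* Fix momenta $(p,p_\varphi)$ and suppose $P^+(r)=P^-(s)=0$ for non-zero integers $r,s$. Then the cohomology of $\hat d_0$ on the subspace of $\mathcal F_{p,p_\varphi}$ annihilated by $L_0=p^+p^-+\hat L_0$ is nonzero only if $rs>0$, and it is then spanned by the classes of the following states: (i) if $r,s<0$: $(\alpha^-_r)^{-s}|p,p_\varphi\rangle$ (ghost number $0$) and $\tilde b_r(\alpha^-_r)^{-s-1}|p,p_\varphi\rangle$ (ghost number $-1$); (ii) if $r,s>0$: $(\alpha^+_{-r})^{s}|p,p_\varphi\rangle$ (ghost number $0$) and $c_{-r}(\alpha^+_{-r})^{s-1}|p,p_\varphi\rangle$ (ghost number $+1$).
   Context: Oscillators ($n\ne0$): $\alpha^\pm_n=\frac1{\sqrt2}(x_n\pm i\varphi_n)$ with $[\alpha^\pm_m,\alpha^\mp_n]=m\delta_{m+n,0}$, $[\alpha^\pm_m,\alpha^\pm_n]=0$; fermionic $\tilde b_n,c_n$ with $\{\tilde b_m,c_n\}=\delta_{m+n,0}$; fermionic $\zeta_n,\tilde\eta_n$ with $\{\zeta_m,\tilde\eta_n\}=\delta_{m+n,0}$; bosonic $\beta_n,\gamma_n$ with $[\gamma_m,\beta_n]=\delta_{m+n,0}$; all other (anti)commutators zero. $\mathcal F_{p,p_\varphi}$ is the Fock space generated by these modes on the vacuum $|p,p_\varphi\rangle$, which is annihilated by all modes with positive index. $p^\pm=\frac1{\sqrt2}\big(p\pm i(p_\varphi+i\sqrt2)\big)$ and $P^\pm(n)=p^\pm\mp n$. $\hat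 L_0$ is the level operator (sum of $-n$ over creation modes with index $n<0$), with $\hat L_0|p,p_\varphi\rangle=0$; $L_0=p^+p^-+\hat L_0$. Ghost number: $c_n,\tilde\eta_n$ carry $+1$, $\tilde b_n,\zeta_n$ carry $-1$, all others $0$, vacuum $0$. The operator $\hat d_0=\sum_{n\ne0}\big(P^+(n)\,c_{-n}\alpha^-_n+\tilde\eta_n\beta_{-n}\big)$ preserves the level and is used as a differential on $\ker L_0$. *)

(* Defs.v *)
From HB Require Import structures.
From mathcomp Require Import all_boot all_order all_algebra.
From mathcomp Require Import finmap.
From mathcomp Require Import boolp classical_sets fsbigop.
Set Implicit Arguments. Unset Strict Implicit. Unset Printing Implicit Defensive.
Import Order.TTheory GRing.Theory Num.Theory.
Local Open Scope ring_scope.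

(* Species of creation modes.                                                *)
(*  bosonic : Ap = alpha^+_{-n}, Am = alpha^-_{-n}, Be = beta_{-n},          *)
(*            Ga = gamma_{-n}                                                *)
(*  fermionic: Bt = btilde_{-n}, Cc = c_{-n}, Ze = zeta_{-n},                *)
(*            Et = etatilde_{-n}                                             *)
(* A key (sp, k) : species * nat denotes the creation mode sp_{-(k+1)}.      *)
Inductive bsp := Ap | Am | Be | Ga.
Definition bsp_to (x : bsp) : nat :=
  match x with Ap => 0 | Am => 1 | Be => 2 | Ga => 3 end.
Definition bsp_of (n : nat) : bsp :=
  match n with 0 => Ap | 1 => Am | 2 => Be | _ => Ga end.
Lemma bsp_K : cancel bsp_to bsp_of. Proof. by case. Qed.
HB.instance Definition _ := Countable.copy bsp (can_type bsp_K).

Inductive fsp := Bt | Cc | Ze | Et.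
Definition fsp_to (x : fsp) : nat :=
  match x with Bt => 0 | Cc => 1 | Ze => 2 | Et => 3 end.
Definition fsp_of (n : nat) : fsp :=
  match n with 0 => Bt | 1 => Cc | 2 => Ze | _ => Et end.
Lemma fsp_K : cancel fsp_to fsp_of. Proof. by case. Qed.
HB.instance Definition _ := Countable.copy fsp (can_type fsp_K).

(* A basis monomial of the Fock space: bosonic occupation numbers and        *)
(* fermionic occupations, both finitely supported.  The monomial stands for  *)
(*   (prod of fermionic creators, in increasing [fcode] order, left to       *)
(*    right) * (prod of bosonic creators ^ occupation) |p, p_phi>.           *)
Definition mono : Type :=
  ({fsfun (bsp * nat)%type -> nat with 0%N} *
   {fsfun (fsp * nat)%type -> bool with false})%type.

Definition vac_mono : mono := ([fsfun with 0%N], [fsfun with false]).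

Definition fcode (x : fsp * nat) : nat := 4 * x.2 + fsp_to x.1.

(* states: coefficient functions on the monomial basis *)
Definition state (C : Type) := mono -> C.

Section Fock.
Variable C : numClosedFieldType.

Definition binc (m : mono) (k : bsp * nat) : mono :=
  ([fsfun m.1 with k |-> (m.1 k).+1], m.2).
Definition bdec (m : mono) (k : bsp * nat) : mono :=
  ([fsfun m.1 with k |-> (m.1 k).-1], m.2).
Definition fupd (m : mono) (k : fsp * nat) (b : bool) : mono :=
  (m.1, [fsfun m.2 with k |-> b]).
(* Koszul sign: (-1)^(number of occupied fermionic modes before k) *)
Definition fsign (m : mono) (k : fsp * nat) : C :=
  (-1) ^+ count (fun x => fcode x < fcode k)%N (finsupp m.2).

Definition bcre (k : bsp * nat) (f : state C) : state C :=
  fun m => if (0 < m.1 k)%N then f (bdec m k) else 0.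
(* bosonic annihilation of key k, with commutator weight w *)
Definition bann (k : bsp * nat) (w : C) (f : state C) : state C :=
  fun m => w * (m.1 k).+1%:R * f (binc m k).
Definition fcre (k : fsp * nat) (f : state C) : state C :=
  fun m => if m.2 k then fsign m k * f (fupd m k false) else 0.
Definition fann (k : fsp * nat) (f : state C) : state C :=
  fun m => if m.2 k then 0 else fsign m k * f (fupd m k true).

Definition zero_op (f : state C) : state C := fun _ => 0.

Definition kidx (n : int) : nat := (absz n).-1.

(* Mode operators, indexed by n : int, n <> 0 (n = 0 gives 0, unused).     *)
(* [alpha^+_m, alpha^-_n] = m delta_{m+n,0}                                 *)
Definition alpha_p (n : int) : state C -> state C :=
  if n < 0 then bcre (Ap, kidx n)
  else if 0 < n then bann (Am, kidx n) n%:~R else zero_op.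
Definition alpha_m (n : int) : state C -> state C :=
  if n < 0 then bcre (Am, kidx n)
  else if 0 < n then bann (Ap, kidx n) n%:~R else zero_op.
(* [gamma_m, beta_n] = delta_{m+n,0} *)
Definition beta (n : int) : state C -> state C :=
  if n < 0 then bcre (Be, kidx n)
  else if 0 < n then bann (Ga, kidx n) (-1) else zero_op.
Definition gamma (n : int) : state C -> state C :=
  if n < 0 then bcre (Ga, kidx n)
  else if 0 < n then bann (Be, kidx n) 1 else zero_op.
(* {btilde_m, c_n} = delta_{m+n,0} *)
Definition btilde (n : int) : state C -> state C :=
  if n < 0 then fcre (Bt, kidx n)
  else if 0 < n then fann (Cc, kidx n) else zero_op.
Definition cgh (n : int) : state C -> state C :=
  if n < 0 then fcre (Cc, kidx n)
  else if 0 < n then fann (Bt, kidx n) else zero_op.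
(* {zeta_m, etatilde_n} = delta_{m+n,0} *)
Definition zeta (n : int) : state C -> state C :=
  if n < 0 then fcre (Ze, kidx n)
  else if 0 < n then fann (Et, kidx n) else zero_op.
Definition etat (n : int) : state C -> state C :=
  if n < 0 then fcre (Et, kidx n)
  else if 0 < n then fann (Ze, kidx n) else zero_op.

Definition vac : state C := fun m => if m == vac_mono then 1 else 0.

Definition fock (f : state C) : Prop :=
  exists S : seq mono, forall m, f m != 0 -> m \in S.

Definition pplus (p pphi : C) : C :=
  (p + 'i * (pphi + 'i * sqrtC 2)) / sqrtC 2.
Definition pminus (p pphi : C) : C :=
  (p - 'i * (pphi + 'i * sqrtC 2)) / sqrtC 2.
Definition Pplus (p pphi : C) (n : int) : C := pplus p pphi - n%:~R.
Definition Pminus (p pphi : C) (n : int) : C := pminus p pphi + n%:~R.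

Definition level (m : mono) : nat :=
  (\sum_(x <- finsupp m.1) (x.2.+1 * m.1 x) +
   \sum_(x <- finsupp m.2) x.2.+1)%N.
Definition Lhat (f : state C) : state C := fun m => (level m)%:R * f m.
Definition L0 (p pphi : C) (f : state C) : state C :=
  fun m => pplus p pphi * pminus p pphi * f m + Lhat f m.

(* d_0 = sum_{n <> 0} ( P^+(n) c_{-n} alpha^-_n + etatilde_n beta_{-n} ),   *)
(* a locally finite sum (finitely many nonzero terms on each basis vector). *)
Definition d0 (p pphi : C) (f : state C) : state C :=
  fun m => \sum_(n \in [set n : int | n != 0]%classic)
     (Pplus p pphi n * cgh (- n) (alpha_m n f) m + etat n (beta (- n) f) m).

Definition in_kerL0 (p pphi : C) (f : state C) : Prop :=
  fock f /\ forall m, L0 p pphi f m = 0.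
Definition cocycle (p pphi : C) (f : state C) : Prop :=
  in_kerL0 p pphi f /\ forall m, d0 p pphi f m = 0.
Definition coboundary (p pphi : C) (f : state C) : Prop :=
  exists g, in_kerL0 p pphi g /\ forall m, f m = d0 p pphi g m.

Definition cohom_spanned_by (p pphi : C) (vs : seq (state C)) : Prop :=
  (forall i, (i < size vs)%N -> cocycle p pphi (nth (fun _ => 0) vs i)) /\
  forall f, cocycle p pphi f ->
    exists cs : seq C, size cs = size vs /\
      coboundary p pphi
        (fun m => f m - \sum_(i < size vs) cs`_i * nth (fun _ => 0) vs i m).

End Fock.

(* Main.v *)
(* The differential exchanges the boson and the fermion inside each of the pairs
   (alpha^-_{-n}, btilde_{-n}), (alpha^+_{-n}, c_{-n}), (beta_{-n}, zeta_{-n}),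
   (gamma_{-n}, etatilde_{-n}): it is a weighted sum of anticommuting Koszul or
   de Rham differentials of one boson-fermion pair each.  The reversed exchange,
   weighted by the inverse weight, is a homotopy whose anticommutator with the
   differential is the number of quanta in the pairs of nonzero weight.  Since
   p^+ = r, exactly one pair has zero weight, so cohomology lives on the
   monomials made of quanta of that pair only; at level r s these are the two
   states of the theorem.  All sums are finite because at level L only the modes
   of index at most L occur. *)
Require Import Defs.
From mathcomp Require Import all_boot all_order all_algebra.
From mathcomp Require Import finmap.
From mathcomp Require Import boolp classical_sets fsbigop.
From mathcomp Require Import zify ring.
Set Implicit Arguments. Unset Strict Implicit. Unset Printing Implicit Defensive.
Import Order.TTheory GRing.Theory Num.Theory.
Local Open Scope ring_scope.

(** * Moving one quantum between a boson and its fermionic partner *)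

Definition partner (i : bsp * nat) : fsp * nat :=
  (match i.1 with Ap => Cc | Am => Bt | Be => Ze | Ga => Et end, i.2).

Definition unpartner (k : fsp * nat) : bsp * nat :=
  (match k.1 with Cc => Ap | Bt => Am | Ze => Be | Et => Ga end, k.2).

Lemma partnerK : cancel partner unpartner. Proof. by case=> [[]]. Qed.

Lemma unpartnerK : cancel unpartner partner. Proof. by case=> [[]]. Qed.

Lemma partner_inj : injective partner. Proof. exact: can_inj partnerK. Qed.

Lemma fcode_inj : injective fcode.
Proof. by move=> [[] k] [[] l]; rewrite /fcode /= => kl; congr pair; lia. Qed.

Definition occ (m : mono) (i : bsp * nat) : nat := (m.1 i + m.2 (partner i))%N.

(* [b = true] stands for the term that turns the fermion of the pair [i] into
   its boson, [b = false] for the reverse one.  As operators act on coefficient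
   functions, [hop_mono b i m] is the monomial whose image contains [m]. *)
Definition hop_mono (b : bool) (i : bsp * nat) (m : mono) : mono :=
  ([fsfun m.1 with i |-> if b then (m.1 i).-1 else (m.1 i).+1],
   [fsfun m.2 with partner i |-> b]).

(** Monomials are unnormalised: creating a boson costs a factor 1, while differentiating the power
    [a + 1] gives [a + 1]. The coefficient is read at the target [m], and its vanishing guards the
    truncated predecessor in [hop_mono]. *)
Definition hop_coef (b : bool) (i : bsp * nat) (m : mono) : nat :=
  if b then (~~ m.2 (partner i) && (0 < m.1 i)%N : nat)
  else if m.2 (partner i) then (m.1 i).+1 else 0%N.

Lemma hop_mono_boson b i m j :
  (hop_mono b i m).1 j =
  if j == i then (if b then (m.1 i).-1 else (m.1 i).+1) else m.1 j.
Proof. by rewrite fsfun_withE. Qed.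

Lemma hop_mono_fermion b i m k :
  (hop_mono b i m).2 k = if k == partner i then b else m.2 k.
Proof. by rewrite fsfun_withE. Qed.

Lemma monoP (m m' : mono) : m.1 =1 m'.1 -> m.2 =1 m'.2 -> m = m'.
Proof. by case: m m' => [a b] [a' b'] /= /fsfunP -> /fsfunP ->. Qed.

Lemma hop_coef_neq i j b b' m : i != j ->
  hop_coef b i (hop_mono b' j m) = hop_coef b i m.
Proof.
move=> ij; rewrite /hop_coef !hop_mono_boson !hop_mono_fermion.
by rewrite (inj_eq partner_inj) (negPf ij).
Qed.

Lemma hop_monoC i j b b' m : i != j ->
  hop_mono b i (hop_mono b' j m) = hop_mono b' j (hop_mono b i m).
Proof.
move=> ij; have ji : j != i by rewrite eq_sym.
have [fij fji] : partner i != partner j /\ partner j != partner i.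
  by rewrite !(inj_eq partner_inj).
apply: monoP => k; rewrite ?hop_mono_boson ?hop_mono_fermion.
  rewrite (negPf ij) (negPf ji); case: (eqVneq k i) => [->|//].
  by rewrite (negPf ij).
by case: (eqVneq k (partner i)) => [->|//]; rewrite (negPf fij).
Qed.

Lemma hop_coef_fermion b i m : hop_coef b i m != 0%N -> m.2 (partner i) = ~~ b.
Proof. by case: b; rewrite /hop_coef; case: (m.2 _). Qed.

Lemma hop_coef_occ b i m : hop_coef b i m != 0%N -> occ m i != 0%N.
Proof.
by case: b; rewrite /hop_coef /occ; case: (m.2 _); case: (m.1 i) => //= *; lia.
Qed.

Lemma hop_monoK b i m : hop_coef b i m != 0%N ->
  hop_mono (~~ b) i (hop_mono b i m) = m.
Proof.
move=> c0; apply: monoP => k; rewrite ?hop_mono_boson ?hop_mono_fermion.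
  case: (eqVneq k i) => [->|//]; rewrite eqxx.
  by move: c0; rewrite /hop_coef; case: b => //=; case: (m.1 i); case: (m.2 _).
case: (eqVneq k (partner i)) => [->|//].
by rewrite (hop_coef_fermion c0).
Qed.

Lemma occ_hop b i m j : hop_coef b i m != 0%N -> occ (hop_mono b i m) j = occ m j.
Proof.
move=> c0; have := hop_coef_fermion c0; move: c0.
rewrite /occ hop_mono_boson hop_mono_fermion (inj_eq partner_inj) /hop_coef.
by case: (eqVneq j i) => [->|//]; case: b; case: (m.2 _); case: (m.1 i) => //=;
  lia.
Qed.

(** * Hop operators and their Koszul signs *)

Section Fock.
Variable C : numClosedFieldType.
Implicit Types (f g : state C) (m : mono) (i j : bsp * nat) (b : bool).

Definition hop b i f : state C :=
  fun m => (hop_coef b i m)%:R * (fsign C m (partner i) * f (hop_mono b i m)).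

(** A balance with the old value on the left and the new one on the right: setting and clearing a
    mode are covered without subtraction. *)
Lemma count_finsupp_with (P : pred (fsp * nat)) (k : fsp * nat) c
    (h : {fsfun (fsp * nat)%type -> bool with false}) :
  (count P (finsupp [fsfun h with k |-> c]) + P k * h k
   = count P (finsupp h) + P k * c)%N.
Proof.
have with_false c' : count P (finsupp [fsfun h with k |-> c']) =
    (P k * c' + count P (finsupp [fsfun h with k |-> false]))%N.
  rewrite !finsupp_with /=; case: c' => /=; last by rewrite muln0.
  rewrite muln1; have /permP -> // :
    perm_eq (k |` finsupp h)%fset (k :: (finsupp h `\ k)%fset).
  by apply: uniq_perm => [||x]; rewrite /= ?fset_uniq ?inE ?eqxx //; case: eqP.
(* Assigning [h k] to [k] changes nothing, so [with_false] also computes the count for [h]. *)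
by have := with_false (h k); rewrite fsfun_with_id with_false => ->; lia.
Qed.

Lemma fsign_hop b i j m : hop_coef b i m != 0%N ->
  fsign C (hop_mono b i m) (partner j) =
  (-1) ^+ (fcode (partner i) < fcode (partner j))%N * fsign C m (partner j).
Proof.
move=> c0; rewrite /fsign -exprD -signr_odd -[RHS]signr_odd; congr (_ ^+ _).
have := count_finsupp_with (fun x => fcode x < fcode (partner j))%N (partner i)
  b m.2.
by rewrite (hop_coef_fermion c0) /=; case: b {c0} => /=; case: (_ < _)%N => /=;
  lia.
Qed.

Lemma fsign_sqr m k : fsign C m k * fsign C m k = 1.
Proof. by rewrite -expr2 sqrr_sign. Qed.

(** The pairs use different fermions, one earlier in [fcode]. Only the hop at the earlier one flips
    the sign seen by the later, so the two orders differ by exactly one sign. *)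
Lemma hop_anticomm b b' i j f m : i != j ->
  hop b i (hop b' j f) m + hop b' j (hop b i f) m = 0.
Proof.
move=> ij; have ji : j != i by rewrite eq_sym.
rewrite /hop !hop_coef_neq // (hop_monoC _ _ _ ij).
have [->|ci] := eqVneq (hop_coef b i m) 0%N; first by rewrite !mul0r !mulr0 addr0.
have [->|cj] := eqVneq (hop_coef b' j m) 0%N; first by rewrite !mul0r !mulr0 addr0.
rewrite !fsign_hop //.
have : fcode (partner i) != fcode (partner j).
  by rewrite (inj_eq fcode_inj) (inj_eq partner_inj).
rewrite neq_ltn => /orP[lt_ij|lt_ij]; rewrite lt_ij ltnNge (ltnW lt_ij) /=;
  rewrite !expr0 !expr1; ring.
Qed.

(** Signs square to one, and at most one order contributes: with [a] bosons it gives [a + 1] if the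
    fermion is present and [a] if it is absent. *)
Lemma hop_number b i f m :
  hop b i (hop (~~ b) i f) m + hop (~~ b) i (hop b i f) m = (occ m i)%:R * f m.
Proof.
have E c : hop c i (hop (~~ c) i f) m =
    (hop_coef c i m * hop_coef (~~ c) i (hop_mono c i m))%:R * f m.
  rewrite /hop; have [->|c0] := eqVneq (hop_coef c i m) 0%N.
    by rewrite mul0n !mul0r.
  rewrite fsign_hop // ltnn expr0 mul1r hop_monoK // natrM.
  rewrite -[RHS]mul1r -(fsign_sqr m (partner i)); ring.
have Ef := E (~~ b); rewrite negbK in Ef; rewrite E Ef -mulrDl -natrD.
congr (_%:R * _); rewrite /hop_coef !hop_mono_boson !hop_mono_fermion !eqxx /occ.
by case: b {Ef}; case: (m.2 _); case: (m.1 i) => //= *; lia.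
Qed.

(** * Contracting homotopy for a weighted sum of hops *)

Section Homotopy.
Variables (w : bsp * nat -> C) (ty : bsp * nat -> bool) (A : seq (bsp * nat)).
Hypothesis uniqA : uniq A.

Definition diff f : state C := fun m => \sum_(i <- A) w i * hop (ty i) i f m.

(** Since the inverse of [0] is [0], pairs of zero weight drop out. *)
Definition homot f : state C :=
  fun m => \sum_(i <- A) (w i)^-1 * hop (~~ ty i) i f m.

Definition number m : nat := \sum_(i <- A | w i != 0) occ m i.

Lemma number_hop b i m : hop_coef b i m != 0%N -> number (hop_mono b i m) = number m.
Proof. by move=> c0; apply: eq_bigr => j _; apply: occ_hop. Qed.

Lemma hop_sum b i (v : bsp * nat -> C) (F : bsp * nat -> state C) m :
  hop b i (fun m' => \sum_(j <- A) v j * F j m') m =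
  \sum_(j <- A) v j * hop b i (F j) m.
Proof. by rewrite /hop !mulr_sumr; apply: eq_bigr => j _; ring. Qed.

(** Distinct pairs cancel by anticommutation; a pair of nonzero weight contributes its occupation,
    one of zero weight nothing. *)
Lemma diff_homot f m :
  diff (homot f) m + homot (diff f) m = (number m)%:R * f m.
Proof.
rewrite /diff /homot; under eq_bigr do rewrite hop_sum mulr_sumr.
under [X in _ + X]eq_bigr do rewrite hop_sum mulr_sumr.
(* The exchange aligns the two double sums term by term; the diagonal is then split off. *)
rewrite [X in _ + X]exchange_big -big_split /= [number m]big_mkcond natr_sum mulr_suml.
apply: eq_big_seq => i iA; rewrite -big_split /= (bigD1_seq i) //= big1 => [|j ji].
  rewrite addr0; have [->|w0] := eqVneq (w i) 0; first by rewrite /=; ring.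
  rewrite -(hop_number (ty i)) (mulrA (w i)) (mulrA (w i)^-1) divff // mulVf //.
  by rewrite !mul1r.
have ij : i != j by rewrite eq_sym.
have /eqP := hop_anticomm (ty i) (~~ ty j) f m ij.
by rewrite addr_eq0 => /eqP ->; rewrite !mulrN mulrCA addNr.
Qed.

Lemma occ_le_number m i : i \in A -> w i != 0 -> (occ m i <= number m)%N.
Proof. by move=> iA wi; rewrite /number big_mkcond (bigD1_seq i) //= wi leq_addr. Qed.

(** A hop preserves [number] and reaches only monomials where its own pair is occupied, so a term of
    nonzero weight would need a positive [number]. *)
Lemma diff_number0 f : (forall m, f m != 0 -> number m = 0%N) -> diff f =1 \0.
Proof.
move=> f0 m; rewrite /diff big_seq big1 // => i iA; rewrite /hop.
have [->|wi] := eqVneq (w i) 0; first by rewrite mul0r.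
have [->|ci] := eqVneq (hop_coef (ty i) i m) 0%N; first by rewrite mul0r mulr0.
have [->|/f0] := eqVneq (f (hop_mono (ty i) i m)) 0; first by rewrite !mulr0.
rewrite number_hop // => n0; have := occ_le_number m iA wi.
by rewrite n0 leqn0 (negPf (hop_coef_occ ci)).
Qed.

Lemma diff_scale (v : nat -> C) f m :
  diff (fun m' => v (number m') * f m') m = v (number m) * diff f m.
Proof.
rewrite /diff mulr_sumr; apply: eq_bigr => i _; rewrite /hop.
have [->|ci] := eqVneq (hop_coef (ty i) i m) 0%N; first by rewrite !mul0r !mulr0.
by rewrite number_hop //; ring.
Qed.

Definition primitive f : state C := fun m => (number m)%:R^-1 * homot f m.

(** For closed [f] the homotopy identity reads [diff (homot f) = number * f], and dividing by
    [number] commutes with [diff]. Where [number] is [0] its inverse is [0], whence the first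
    branch. *)
Lemma diff_primitive f : diff f =1 \0 ->
  forall m, diff (primitive f) m = if number m == 0%N then 0 else f m.
Proof.
move=> df m; rewrite /primitive (diff_scale (fun n => n%:R^-1)).
have := diff_homot f m; rewrite [homot _ m]big1 ?addr0 => [->|i _].
  case: eqP => [->|/eqP n0]; first by rewrite mul0r mulr0.
  by rewrite mulKf // pnatr_eq0.
by rewrite /hop df !mulr0.
Qed.

Lemma homot_neq0 f m : homot f m != 0 ->
  exists i, [/\ i \in A, hop_coef (~~ ty i) i m != 0%N
    & f (hop_mono (~~ ty i) i m) != 0].
Proof.
apply: contraNP => none; rewrite /homot big_seq big1 // => i iA; rewrite /hop.
have [->|ci] := eqVneq (hop_coef (~~ ty i) i m) 0%N; first by rewrite mul0r mulr0.
have [->|fi] := eqVneq (f (hop_mono (~~ ty i) i m)) 0; first by rewrite !mulr0.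
by case: none; exists i.
Qed.

Lemma fock_homot f : fock f -> fock (homot f).
Proof.
(* Every monomial of [homot f] is one inverse hop away from [S]. *)
move=> [S fS]; exists [seq hop_mono (ty i) i m | i <- A, m <- S] => m.
move=> /homot_neq0[i [iA ci /fS mS]]; apply/allpairsP.
exists (i, hop_mono (~~ ty i) i m); split=> //=.
by have := hop_monoK ci; rewrite negbK => ->.
Qed.

End Homotopy.

(** * The level as a sum over pairs *)

Definition modes (L : nat) : seq (bsp * nat) :=
  [seq (x, k) | x <- [:: Ap; Am; Be; Ga], k <- iota 0 L].

Lemma mem_modes L i : (i \in modes L) = (i.2 < L)%N.
Proof.
apply/allpairsP/idP => [[[x k] [_ /= kL ->]]|iL]; first by rewrite mem_iota in kL.
by exists i; rewrite mem_iota; split=> //; [case: i {iL} => [[]] | case: i iL].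
Qed.

Lemma modes_uniq L : uniq (modes L).
Proof. by apply: allpairs_uniq; rewrite ?iota_uniq // => -[? ?] [? ?] _ _. Qed.

(** A boson and its partner have the same mode index, so the level sees only pair occupations. *)
Lemma levelE A m : uniq A -> (forall i, occ m i != 0%N -> i \in A) ->
  level m = (\sum_(i <- A) i.2.+1 * occ m i)%N.
Proof.
move=> uA sA; under eq_bigr do rewrite mulnDr; rewrite big_split /level; congr addn.
  rewrite [RHS](bigID (fun i => m.1 i != 0%N)) /= addnC [X in (X + _)%N]big1 => [|i]; last first.
    by rewrite negbK => /eqP->; rewrite muln0.
  rewrite add0n -[RHS]big_filter; apply: perm_big; apply: uniq_perm.
  - exact: fset_uniq.
  - exact: filter_uniq.
  move=> i; rewrite mem_finsupp mem_filter; case: (boolP (m.1 i != 0%N)) => // mi.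
  by rewrite sA //; rewrite /occ; lia.
rewrite [RHS](bigID (fun i => m.2 (partner i))) /= addnC [X in (X + _)%N]big1 => [|i /negPf->];
  last by rewrite muln0.
rewrite add0n -[RHS]big_filter.
transitivity (\sum_(x <- map partner [seq i <- A | m.2 (partner i)]) x.2.+1)%N.
  apply: perm_big; apply: uniq_perm.
  - exact: fset_uniq.
  - by rewrite (map_inj_uniq partner_inj) filter_uniq.
  move=> k; rewrite -[k]unpartnerK (mem_map partner_inj) mem_filter mem_finsupp.
  rewrite eqbF_neg negbK; case: (boolP (m.2 _)) => // mk.
  by rewrite sA // /occ mk; lia.
by rewrite big_map big_filter [RHS]big_filter; apply: eq_bigr => i ->; rewrite muln1.
Qed.

Lemma occ_level m i : occ m i != 0%N -> (i.2 < level m)%N.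
Proof.
move=> mi; pose A := undup (finsupp m.1 ++ map unpartner (finsupp m.2)).
have sA j : occ m j != 0%N -> j \in A.
  rewrite mem_undup mem_cat mem_finsupp -{3}[j]partnerK.
  rewrite (mem_map (can_inj unpartnerK)) mem_finsupp /occ.
  by case: (m.1 j) => //=; case: (m.2 _).
rewrite (levelE (undup_uniq _) sA) (bigD1_seq i) ?undup_uniq ?sA //=.
by case: (occ m i) mi => // n _; rewrite mulnS; lia.
Qed.

Lemma level_modes L m : (level m <= L)%N ->
  level m = (\sum_(i <- modes L) i.2.+1 * occ m i)%N.
Proof.
move=> mL; apply: levelE (modes_uniq L) _ => i /occ_level iL.
by rewrite mem_modes (leq_trans iL).
Qed.

Lemma level_hop b i m : hop_coef b i m != 0%N -> level (hop_mono b i m) = level m.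
Proof.
(* A common bound lets one list of modes serve both monomials. *)
move=> ci; pose L := maxn (level (hop_mono b i m)) (level m).
rewrite (@level_modes L) ?leq_maxl // (@level_modes L m) ?leq_maxr //.
by apply: eq_bigr => j _; rewrite occ_hop.
Qed.

(** * The operator [d0] as a weighted sum of hops *)

Definition weight (p pphi : C) i : C :=
  let n := i.2.+1%:Z in
  match i.1 with
  | Ap => Pplus p pphi n * n%:~R
  | Am => Pplus p pphi (- n)
  | Be => 1
  | Ga => - 1
  end.

(* The pairs whose term in the differential turns the fermion into the boson. *)
Definition koszul i : bool := match i.1 with Am | Be => true | _ => false end.

(** The weight of [Ap] has its factor [n] from the commutator of [alpha_m n] with [alpha_p (- n)];
    the [- 1] of [Ga] is the commutator of [beta n] with [gamma (- n)]. Keys store the mode index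
    minus one. *)
Lemma d0_termE p pphi n f m : n != 0 ->
  let t i := weight p pphi i * hop (koszul i) i f m in
  Pplus p pphi n * cgh (- n) (alpha_m n f) m + etat n (beta (- n) f) m =
  match n with
  | Posz k => t (Ap, k.-1) + t (Be, k.-1)
  | Negz k => t (Am, k) + t (Ga, k)
  end.
Proof.
case: n => [[//|k]|k] _ /=.
  rewrite /cgh /alpha_m /etat /beta /kidx /hop /hop_coef /= /fcre /bann /fann /bcre.
  congr (_ + _); rewrite /weight /= /partner /=.
    by case: (m.2 _) => /=; rewrite ?mul0r ?mulr0 // /hop_mono /binc /fupd /=; ring.
  case: (m.2 _) => /=; rewrite ?mul0r ?mulr0 //.
  by case: (m.1 _) => [|a] /=; rewrite ?mul0r ?mulr0 // !mul1r.
rewrite /cgh /alpha_m /etat /beta /kidx /hop /hop_coef /= /fcre /bann /fann /bcre.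
congr (_ + _); rewrite /weight /= /partner /=.
  case: (m.2 _) => /=; rewrite ?mul0r ?mulr0 //.
  by case: (m.1 _) => [|a] /=; rewrite ?mul0r ?mulr0 // !mul1r.
by case: (m.2 _) => /=; rewrite ?mul0r ?mulr0 // /hop_mono /binc /fupd /=; ring.
Qed.

(** A pair of mode index above [L] is empty at level at most [L], so its term vanishes and the sum
    over all integers stops there. *)
Lemma d0_modes p pphi L f m : (level m <= L)%N ->
  d0 p pphi f m = diff (weight p pphi) koszul (modes L) f m.
Proof.
move=> mL; rewrite /d0.
set t := fun i => weight p pphi i * hop (koszul i) i f m.
have t0 i : (L <= i.2)%N -> t i = 0.
  move=> Li; rewrite /t /hop.
  have [->|/hop_coef_occ/occ_level] := eqVneq (hop_coef (koszul i) i m) 0%N.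
    by rewrite mul0r mulr0.
  by move=> /leq_trans /(_ mL); rewrite ltnNge Li.
(* All nonzero integers of absolute value at most [L]; [Negz k] is [-(k + 1)]. *)
pose R := [seq Posz k.+1 | k <- iota 0 L] ++ [seq Negz k | k <- iota 0 L].
have R0 n : n \in R -> n != 0 by rewrite mem_cat => /orP[] /mapP[k _ ->].
rewrite (fsbigE R); first last.
- move=> n /= n0 nR; rewrite d0_termE //; case: n n0 nR => [[//|k]|k] _;
    rewrite mem_cat negb_or => /andP[]; rewrite /= -!/(t _) => nP nN.
    rewrite !t0 ?addr0 //= leqNgt; apply: contra nP => kL;
      by apply: map_f; rewrite mem_iota.
  rewrite !t0 ?addr0 //= leqNgt; apply: contra nN => kL;
    by apply: map_f; rewrite mem_iota.
- by move=> n /= /R0.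
- rewrite cat_uniq !map_inj_uniq ?iota_uniq //=; try by move=> ? ? [].
  by rewrite andbT; apply/hasPn => n /mapP[k _ ->]; apply/negP => /mapP[].
transitivity (\sum_(n <- R) match n with
    | Posz k => t (Ap, k.-1) + t (Be, k.-1)
    | Negz k => t (Am, k) + t (Ga, k) end).
  rewrite big_seq_cond [RHS]big_seq; apply: eq_big => n.
    by apply: andb_idr => /R0; rewrite inE.
  by move=> /andP[/R0 n0 _]; apply: d0_termE.
rewrite /diff big_allpairs !big_cons big_nil big_cat !big_map /= !big_split /=.
rewrite -!/(t _); ring.
Qed.

Lemma diff_level w ty A L f : (forall m, f m != 0 -> level m = L) ->
  forall m, diff w ty A f m != 0 -> level m = L.
Proof.
move=> fL m; apply: contraNeq => mL; rewrite /diff big1 // => i _; rewrite /hop.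
have [->|ci] := eqVneq (hop_coef (ty i) i m) 0%N; first by rewrite mul0r mulr0.
have [->|/fL] := eqVneq (f (hop_mono (ty i) i m)) 0; first by rewrite !mulr0.
by rewrite level_hop // => mE; rewrite mE eqxx in mL.
Qed.

Lemma d0_level p pphi L f : (forall m, f m != 0 -> level m = L) ->
  d0 p pphi f =1 diff (weight p pphi) koszul (modes L) f.
Proof.
move=> fL m; have [/d0_modes->//|Lm] := leqP (level m) L.
(* Above level [L] both sides vanish, because hops preserve the level. *)
rewrite (d0_modes _ _ _ (leqnn _)); have mL : level m != L by rewrite gtn_eqF.
transitivity (0 : C); [|apply/esym]; apply: contra_eq mL.
  by move=> /(diff_level fL) ->; rewrite eqxx.
by move=> /(diff_level fL) ->; rewrite eqxx.
Qed.

(** * Consequences of the momentum conditions *)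

Section Momenta.
Variables (p pphi : C) (r s : int).
Hypotheses (Pr : Pplus p pphi r = 0) (Ps : Pminus p pphi s = 0).

(** The hypotheses say that [pplus] is [r] and [pminus] is [- s], so their product is
    [- (r * s)]. *)
Lemma L0E f m : L0 p pphi f m = ((level m)%:Z - r * s)%:~R * f m.
Proof.
move/eqP: Pr; rewrite subr_eq0 => /eqP pE; move/eqP: Ps; rewrite addr_eq0 => /eqP mE.
by rewrite /L0 /Lhat pE mE -mulrDl rmorphB rmorphM /= mulrN addrC.
Qed.

Lemma in_kerL0P f : in_kerL0 p pphi f <->
  fock f /\ forall m, f m != 0 -> (level m)%:Z = r * s.
Proof.
split=> [[ff f0]|[ff fL]]; split=> // m.
  move=> fm; have /eqP := f0 m; rewrite L0E mulf_eq0 (negPf fm) orbF intr_eq0.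
  by rewrite subr_eq0 => /eqP.
rewrite L0E; have [->|/fL ->] := eqVneq (f m) 0; first by rewrite mulr0.
by rewrite subrr mul0r.
Qed.

Definition special : bsp * nat :=
  match r with Posz k => (Ap, k.-1) | Negz k => (Am, k) end.

(** Here [Pplus] at [n] is [r - n], zero only at [n = r]; the [Ap] modes realise the positive [n]
    and the [Am] modes the negative ones. *)
Lemma weight_eq0 i : r != 0 -> (weight p pphi i == 0) = (i == special).
Proof.
have PE n : (Pplus p pphi n == 0) = (n == r).
  move/eqP: Pr; rewrite /Pplus subr_eq0 => /eqP ->.
  by rewrite -rmorphB intr_eq0 subr_eq0 eq_sym.
rewrite /weight /special; case: i r PE => x k [[//|a]|a] PE _;
  rewrite xpair_eqE; case: x => /=;
  rewrite ?mulf_eq0 ?oppr_eq0 ?oner_eq0 ?PE ?intr_eq0 ?orbF //.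
Qed.

End Momenta.

(** * Monomials made of quanta of a single pair *)

Definition quanta n i : mono :=
  ([fsfun [fsfun with 0%N] with i |-> n], [fsfun with false]).

Definition fquanta n i : mono := fupd (quanta n i) (partner i) true.

(** The fermion can hold at most one of the [n + 1] quanta, which leaves two distributions. *)
Lemma occ_special n i m :
  (forall j, occ m j = if j == i then n.+1 else 0%N) <->
  (m = quanta n.+1 i \/ m = fquanta n i).
Proof.
split=> [mocc|]; last first.
  case=> -> j; rewrite /occ /= !fsfun_withE ?fsfun0E ?addn0 //.
  by rewrite (inj_eq partner_inj); case: eqP; rewrite ?addn1.
have m2 k : m.2 k = m.2 (partner i) && (k == partner i).
  rewrite -[k]unpartnerK (inj_eq partner_inj); have := mocc (unpartner k).
  by rewrite /occ; case: eqP => [->|_]; rewrite ?andbT ?andbF //; case: (m.2 _); lia.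
have m1 j : m.1 j = if j == i then (n.+1 - m.2 (partner i))%N else 0%N.
  by have := mocc j; rewrite /occ; case: eqP => [->|_]; lia.
case E: (m.2 (partner i)); [right|left]; apply: monoP => j.
- by rewrite m1 E /= fsfun_withE fsfun0E subn1.
- by rewrite m2 E /= fsfun_withE fsfun0E; case: eqP.
- by rewrite m1 E /= fsfun_withE fsfun0E subn0.
- by rewrite m2 E /= fsfun0E.
Qed.

Lemma level_special m L i n : L = (n.+1 * i.2.+1)%N ->
  (forall j, occ m j = if j == i then n.+1 else 0%N) <->
  (level m = L /\ forall j, j \in modes L -> j != i -> occ m j = 0%N).
Proof.
move=> LE; have iL : i \in modes L by rewrite mem_modes LE; nia.
split=> [mocc|[mL m0] j].
  split=> [|j _ /negPf ji]; last by rewrite mocc ji.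
  rewrite (levelE (modes_uniq L)) => [|j]; last first.
    by rewrite mocc; case: (eqVneq j i) => [->|].
  rewrite (bigD1_seq i) ?modes_uniq //= big1 => [|j /negPf ji].
    by rewrite mocc eqxx LE addn0 mulnC.
  by rewrite mocc ji muln0.
case: (eqVneq j i) => [->|ji].
  (* With all other pairs empty the level is a single term; cancelling the mode index gives the
     occupation. *)
  have := level_modes (eq_leq mL).
  rewrite mL (bigD1_seq i) ?modes_uniq //= big_seq_cond big1 ?addn0.
    by rewrite LE mulnC => /eqP; rewrite eqn_pmul2l // => /eqP.
  by move=> k /andP[kL ki]; rewrite m0 ?muln0.
(* An occupied pair has mode index at most the level, hence lies in [modes L]. *)
apply/eqP; apply: contraTT isT => /[dup] /occ_level; rewrite mL -mem_modes => jL.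
by rewrite m0.
Qed.

(** Creation carries no normalisation factor, so no factorial appears. *)
Lemma iter_bcre_vac n i m : iter n (bcre i) (@vac C) m = (m == quanta n i)%:R.
Proof.
elim: n m => [|n IHn] m /=.
  rewrite /vac (_ : quanta 0 i = vac_mono); first by case: eqP.
  by apply: monoP => j //=; rewrite fsfun_withE fsfun0E; case: eqP.
rewrite /bcre IHn; case: ltnP => mi; last first.
  by case: eqP => // mE; move: mi; rewrite mE /= fsfun_with.
congr (_%:R : C); congr nat_of_bool; apply/eqP/eqP => mE; apply: monoP => j.
- have := congr1 (fun m' : mono => m'.1 j) mE; rewrite /= !fsfun_withE.
  by case: eqP => [-> <-|//]; rewrite prednK.
- by have := congr1 (fun m' : mono => m'.2 j) mE.
- by rewrite mE /= !fsfun_withE eqxx; case: eqP.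
- by rewrite mE.
Qed.

Lemma fcre_iter_vac n i m :
  fcre (partner i) (iter n (bcre i) (@vac C)) m = (m == fquanta n i)%:R.
Proof.
rewrite /fcre iter_bcre_vac; case: ifP => mi; last first.
  by case: eqP => // mE; move: mi; rewrite mE /= fsfun_with.
have -> : (fupd m (partner i) false == quanta n i) = (m == fquanta n i).
  apply/eqP/eqP => mE; apply: monoP => j.
  - by have := congr1 (fun m' : mono => m'.1 j) mE.
  - have := congr1 (fun m' : mono => m'.2 j) mE; rewrite /= !fsfun_withE.
    by case: eqP => [->|].
  - by rewrite mE.
  - by rewrite mE /= !fsfun_withE fsfun0E; case: eqP.
case: eqP => [->|_]; last by rewrite mulr0.
(* The only fermion present does not precede itself, so the sign is trivial. *)
rewrite mulr1 /fsign (@eq_in_count _ _ pred0) ?count_pred0 // => k.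
by rewrite mem_finsupp /= fsfun_withE fsfun0E;
  case: (eqVneq k (partner i)) => [-> _|//]; rewrite ltnn.
Qed.

(** * Cohomology at level [r * s] *)

Lemma cohom_special p pphi r s n : r != 0 ->
  Pplus p pphi r = 0 -> Pminus p pphi s = 0 ->
  r * s = (n.+1 * (special r).2.+1)%N%:Z ->
  let i := special r in
  cohom_spanned_by p pphi
    [:: iter n.+1 (bcre i) (@vac C); fcre (partner i) (iter n (bcre i) (@vac C))].
Proof.
move=> r0 Pr Ps; set i := special r; set L := (_ * _)%N => rsL.
pose w := weight p pphi; pose N := number w (modes L).
have kerL0P f : in_kerL0 p pphi f <-> fock f /\ forall m, f m != 0 -> level m = L.
  rewrite (in_kerL0P Pr Ps) rsL.
  by split=> -[ff fL]; split=> // m /fL; [case | move->].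
(* Zero [number] confines the quanta to the pair of zero weight, and level [L] fixes their count to
   [n + 1]. *)
have N0P m : N m = 0%N /\ level m = L <-> m = quanta n.+1 i \/ m = fquanta n i.
  rewrite -occ_special (level_special _ (erefl L)).
  split=> [[N0 mL]|[mL m0]]; split=> //.
    move=> j jL ji.
    apply/eqP; rewrite -leqn0 -N0; apply: occ_le_number jL _; first exact: modes_uniq.
    by rewrite (weight_eq0 Pr).
  rewrite /N /number big_seq_cond big1 // => j /andP[jL].
  by rewrite (weight_eq0 Pr) // => /(m0 j jL).
have delta_cocycle m0 f : N m0 = 0%N /\ level m0 = L ->
    (forall m, f m = (m == m0)%:R) -> cocycle p pphi f.
  move=> [Nm0 Lm0] fE.
  have supp m : f m != 0 -> m = m0 by rewrite fE; case: (eqVneq m m0); rewrite ?eqxx.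
  have fL m : f m != 0 -> level m = L by move=> /supp ->.
  split; first by apply/kerL0P; split=> //; exists [:: m0] => m /supp ->; rewrite inE.
  move=> m; rewrite (d0_level _ _ fL) (diff_number0 koszul (modes_uniq L)) //.
  by move=> m' /supp ->.
split=> [[|[|//]] _ /=|f [/kerL0P[ff fL] df]].
- by apply: delta_cocycle (iter_bcre_vac n.+1 i); apply/N0P; left.
- by apply: delta_cocycle (fcre_iter_vac n i); apply/N0P; right.
(* Off the two monomials [f] equals the differential of its primitive; at them the latter vanishes,
   so the coefficients are the values of [f]. *)
exists [:: f (quanta n.+1 i); f (fquanta n i)]; split=> //.
have gL m : primitive w koszul (modes L) f m != 0 -> level m = L.
  rewrite /primitive mulf_eq0 negb_or => /andP[_].
  by move=> /homot_neq0[j [_ cj /fL]]; rewrite level_hop.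
exists (primitive w koszul (modes L) f); split.
  apply/kerL0P; split=> //.
  have [S gS] := fock_homot w koszul (modes L) ff; exists S => m.
  by rewrite /primitive mulf_eq0 negb_or => /andP[_ /gS].
move=> m; rewrite (d0_level _ _ gL) diff_primitive ?modes_uniq //; last first.
  by move=> m'; rewrite -(d0_level _ _ fL).
rewrite -/(N m) !big_ord_recl big_ord0 addr0 /= !fcre_iter_vac -/(iter n.+1 _ _) iter_bcre_vac.
have qf : quanta n.+1 i != fquanta n i.
  by apply/eqP => /(congr1 (fun m' : mono => m'.1 i)); rewrite /= !fsfun_with; lia.
case: (eqVneq m (quanta n.+1 i)) => [mq|mq].
  by rewrite (proj2 (N0P m) (or_introl mq)).1 mq (negPf qf) mulr1 mulr0 addr0 subrr.
case: (eqVneq m (fquanta n i)) => [mf|mf].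
  by rewrite (proj2 (N0P m) (or_intror mf)).1 mf mulr0 mulr1 add0r subrr.
(* Any other monomial of zero [number] is not of level [L], so [f] vanishes there. *)
rewrite !mulr0 addr0 subr0; case: eqP => // N0.
apply/eqP; apply: contraTT isT => /fL mL.
by have /N0P[/eqP|/eqP] := conj N0 mL; rewrite ?(negPf mq) ?(negPf mf).
Qed.

(** The kernel of [L0] sits at level [r * s], and a level is a natural number, so the kernel is
    zero. *)
Lemma cohom_negative p pphi r s : Pplus p pphi r = 0 -> Pminus p pphi s = 0 ->
  r * s < 0 -> @cohom_spanned_by C p pphi [::].
Proof.
move=> Pr Ps rs; split=> // f [/(in_kerL0P Pr Ps)[_ fL] _]; exists [::]; split=> //.
have f0 m : f m = 0.
  by apply/eqP; apply: contraTT rs => /fL <-.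
have z0 : in_kerL0 p pphi (fun _ => 0).
  by split=> [|m]; [exists [::] => m; rewrite eqxx | rewrite (L0E Pr Ps) mulr0].
exists (fun _ => 0); split=> // m.
rewrite big_ord0 f0 subr0 (d0_modes _ _ _ (leqnn _)) /diff big1 // => i _.
by rewrite /hop !mulr0.
Qed.

End Fock.

Theorem theorem4 (C : numClosedFieldType) (p pphi : C) (r s : int) :
  r != 0 -> s != 0 ->
  Pplus p pphi r = 0 -> Pminus p pphi s = 0 ->
  [/\ r * s < 0 -> cohom_spanned_by p pphi [::],
      r < 0 -> s < 0 ->
        cohom_spanned_by p pphi
          [:: iter `|s|%N (alpha_m r) (vac C);
              btilde r (iter `|s|.-1 (alpha_m r) (vac C))]
    & 0 < r -> 0 < s ->
        cohom_spanned_by p pphi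
          [:: iter `|s|%N (alpha_p (- r)) (vac C);
              cgh (- r) (iter `|s|.-1 (alpha_p (- r)) (vac C))]].
Proof.
move=> r0 s0 Pr Ps; split=> [|rlt slt|rgt sgt].
- exact: cohom_negative Pr Ps.
(* [Negz k] is [-(k + 1)], so the constructors yield the key index [k] and [n = |s| - 1]. *)
- case: r s r0 {s0} Pr Ps rlt slt => [//|k] [//|n] r0 Pr Ps _ _.
  by apply: (cohom_special (n := n) r0 Pr Ps); rewrite /=; lia.
- case: r s r0 {s0} Pr Ps rgt sgt => [[//|k]|//] [[//|n]|//] r0 Pr Ps _ _.
  by apply: (cohom_special (n := n) r0 Pr Ps); rewrite /=; lia.
Qed.
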